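(* Let $r\ge 1$ and let $b_1,b_2,\dots,b_r$ be integers. Then there exists an $r\times r$ matrix $f$ with integer entries such that $b_i=\operatorname{Tr}(f^i)$ for all $1\le i\le r$ if and only if the following condition holds for every integer $n$ with $1\le n\le r$: whenever $p$ is a prime, $k\ge 1$ and $m\ge 1$ are integers, $n=mp^k$ and $\gcd(m,p)=1$, one has $$b_n\equiv b_{n/p}\pmod{p^k}.$$
   Context: $\operatorname{Tr}$ denotes the trace of a square matrix. *)

(* Defs.v *)
From mathcomp Require Export all_boot all_order all_algebra.

(* Main.v *)
Require Import Defs.
From mathcomp Require Import all_boot all_order all_algebra.
From mathcomp Require Import zify.
Import GRing.Theory.
Local Open Scope ring_scope.

(** With [P = det (1 - X f)], Newton's identities say [- X P' / P] is the
    generating series of [Tr (f^n)].  By companion matrices, [b_1, ..., b_r] are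
    traces of powers of an integer matrix as soon as some integer [P] with
    [P(0) = 1] satisfies Newton's identities up to degree [r].
    Both conditions of the theorem are equivalent to the existence of integers
    [a_d] with [b_n = \sum_(d %| n) d a_d]: such sums are the Newton sums of
    [\prod_d (1 - X^d)^(a_d)].  The [a_d] are constructed one at a time; what is
    needed is [n %| b_n - c_n] where [c] is the sum built from the [a_d], [d < n].
    Starting from a matrix, this holds because two polynomials whose Newton sums
    agree below [n] have [n]-th Newton sums differing by [n] times the difference
    of their [n]-th coefficients; starting from the congruences, it is checked at
    each prime power exactly dividing [n], as [c] satisfies them too. *)

Set Implicit Arguments.
Unset Strict Implicit.
Unset Printing Implicit Defensive.

(** * Newton's identities as power series identities modulo ['X^N.+1] *)

Definition newton (N : nat) (P : {poly int}) (b : nat -> int) : Prop :=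
  forall n, (0 < n <= N)%N -> P`_n *+ n + \sum_(i < n) P`_i * b (n - i)%N = 0.

Lemma eq_newton (N : nat) (P : {poly int}) (b c : nat -> int) :
  (forall n, (0 < n <= N)%N -> b n = c n) -> newton N P b -> newton N P c.
Proof.
move=> eq_bc newtP n /andP[n_gt0 leqnN].
rewrite -[RHS](newtP n) ?n_gt0 //; congr (_ + _); apply: eq_bigr => i _.
by rewrite eq_bc // subn_gt0 ltn_ord (leq_trans (leq_subr _ _)).
Qed.

(** The constant term is dropped because Newton's identities do not involve [b 0], which for traces
    is the size of the matrix. *)
Definition trunc_series (N : nat) (b : nat -> int) : {poly int} :=
  \poly_(j < N.+1) (b j *+ (0 < j)%N).

Definition newton_defect (N : nat) (P : {poly int}) (b : nat -> int) : {poly int} :=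
  'X * P^`() + P * trunc_series N b.

Lemma coef_newton_defect (N : nat) (P : {poly int}) (b : nat -> int) (n : nat) :
  (n <= N)%N ->
  (newton_defect N P b)`_n = P`_n *+ n + \sum_(i < n) P`_i * b (n - i)%N.
Proof.
move=> leqnN; rewrite coefD coefXM coef_deriv coefM big_ord_recr /= subnn.
rewrite [(trunc_series N b)`_0]coef_poly mulr0n mulr0 addr0; congr (_ + _).
  by case: n {leqnN} => [|n]; rewrite ?mulr0n.
apply: eq_bigr => i _; rewrite coef_poly ltnS (leq_trans (leq_subr _ _)) //.
by rewrite subn_gt0 ltn_ord mulr1n.
Qed.

Lemma newtonP (N : nat) (P : {poly int}) (b : nat -> int) :
  newton N P b <-> (forall n, (n <= N)%N -> (newton_defect N P b)`_n = 0).
Proof.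
split=> [newtP n leqnN | defP n /andP[_ leqnN]].
  rewrite coef_newton_defect //; case: n leqnN => [|n] leqnN.
    by rewrite mulr0n big_ord0 addr0.
  exact: newtP.
by rewrite -(coef_newton_defect _ _ leqnN) defP.
Qed.

Lemma trunc_seriesD (N : nat) (b c : nat -> int) :
  trunc_series N (fun n => b n + c n) = trunc_series N b + trunc_series N c.
Proof.
by apply/polyP=> n; rewrite coefD !coef_poly; case: ifP; rewrite ?addr0 ?mulrnDl.
Qed.

(** Leibniz rule: logarithmic derivatives turn products into sums. *)
Lemma newton_defectM (N : nat) (P Q : {poly int}) (b c : nat -> int) :
  newton_defect N (P * Q) (fun n => b n + c n) =
  Q * newton_defect N P b + P * newton_defect N Q c.
Proof.
rewrite /newton_defect trunc_seriesD derivM !mulrDr [RHS]addrACA; congr (_ + _).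
  by rewrite (mulrCA P) (mulrCA Q) (mulrC Q P^`()).
by rewrite (mulrCA Q) mulrA (mulrA P Q).
Qed.

Lemma coefM_low0 (N : nat) (P Q : {poly int}) :
  (forall n, (n <= N)%N -> Q`_n = 0) -> forall n, (n <= N)%N -> (P * Q)`_n = 0.
Proof.
move=> Q0 n leqnN; rewrite coefM big1 // => i _.
by rewrite Q0 ?mulr0 // (leq_trans (leq_subr _ _)).
Qed.

Lemma newtonM (N : nat) (P Q : {poly int}) (b c : nat -> int) :
  newton N P b -> newton N Q c -> newton N (P * Q) (fun n => b n + c n).
Proof.
move=> /newtonP P0 /newtonP Q0; apply/newtonP => n leqnN.
by rewrite newton_defectM coefD !(@coefM_low0 N) ?addr0.
Qed.

(** A polynomial with constant term 1 is invertible as a power series, so it can be cancelled degree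
    by degree in front of the defect of [Q]. *)
Lemma newton_divl (N : nat) (P Q : {poly int}) (b c : nat -> int) :
  P`_0 = 1 -> newton N P b -> newton N (P * Q) (fun n => b n + c n) ->
  newton N Q c.
Proof.
move=> P01 /newtonP P0 /newtonP PQ0; apply/newtonP.
elim/ltn_ind=> n IHn leqnN; have := PQ0 n leqnN.
rewrite newton_defectM coefD (@coefM_low0 N) // add0r coefM big_ord_recl /=.
rewrite P01 mul1r subn0 big1 ?addr0 // => i _; rewrite IHn ?mulr0 //.
  by rewrite ltn_subrL (leq_trans _ (ltn_ord i)).
by rewrite (leq_trans (leq_subr _ _)).
Qed.

(** * Newton sums of products of powers of [1 - 'X^d] *)

Lemma newton_const (N : nat) : newton N 1 (fun=> 0).
Proof.
move=> n /andP[n_gt0 _]; rewrite coef1 -[n in n == _]prednK //= mul0rn add0r.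
by rewrite big1 // => i _; rewrite mulr0.
Qed.

Lemma newton_subXn (N n : nat) :
  (0 < n)%N -> newton N (1 - 'X^n) (fun m => n%:Z *+ (n %| m)%N).
Proof.
move=> n_gt0; apply/newtonP => m lemN.
rewrite /newton_defect derivB derivC derivXn sub0r mulrN mulrnAr -exprS.
rewrite prednK // mulrBl mul1r coefD coefN coefMn coefB coefXn coefXnM.
rewrite !coef_poly ltnS lemN ltnS (leq_trans (leq_subr _ _) lemN).
case: (ltngtP m n) => [ltmn | ltnm | ->]; rewrite ?mul0rn ?oppr0 ?add0r ?subr0.
- case: m ltmn {lemN} => [|m] ltmn; rewrite ?mulr0n //.
  by rewrite mulr1n gtnNdvd.
- by rewrite subn_gt0 ltnm (ltn_trans n_gt0 ltnm) dvdn_subl ?(ltnW ltnm) ?subrr.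
by rewrite subnn dvdnn n_gt0 !mulr1n mulr0n subr0 natz addNr.
Qed.

Lemma newton_factor (N n : nat) (a : int) : (0 < n)%N ->
  exists P : {poly int},
    P`_0 = 1 /\ newton N P (fun m => (n%:Z * a) *+ (n %| m)%N).
Proof.
move=> n_gt0; elim/int_ind: a => [|k [P [P01 newtP]]|k [P [P01 newtP]]].
- exists 1; rewrite coef1; split=> //; apply: eq_newton (@newton_const N) => m _.
  by rewrite mulr0 mul0rn.
- exists (P * (1 - 'X^n)); split.
    rewrite coef0M P01 mul1r coefB coef1 coefXn eqxx /=.
    by rewrite eq_sym (gtn_eqF n_gt0) subr0.
  apply: eq_newton (newtonM newtP (@newton_subXn N n n_gt0)) => m _.
  by rewrite -mulrnDl intS mulrDr mulr1 addrC.
(* Modulo ['X^N.+1] this is the inverse of [1 - 'X^n]. *)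
pose Q : {poly int} := \sum_(j < N.+1) 'X^n ^+ j.
have Q01 : Q`_0 = 1.
  rewrite coef_sum big_ord_recl expr0 coef1 big1 ?addr0 // => i _.
  by rewrite -exprM coefXn eq_sym muln_eq0 (gtn_eqF n_gt0).
exists (P * Q); split; first by rewrite coef0M P01 Q01.
have newtQ : newton N Q (fun m => - (n%:Z *+ (n %| m)%N)).
  apply: newton_divl (@newton_subXn N n n_gt0) _.
    by rewrite coefB coef1 coefXn eqxx eq_sym (gtn_eqF n_gt0) subr0.
  have -> : (1 - 'X^n) * Q = 1 - 'X^(n * N.+1) :> {poly int}.
    by rewrite exprM -[in RHS](expr1n _ N.+1) subrXX; congr (_ * _);
       apply: eq_bigr => i _; rewrite expr1n mul1r.
  (* The Newton sums of [1 - 'X^(n * N.+1)] vanish up to degree [N], since [n * N.+1] exceeds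
     [N]. *)
  apply: eq_newton (@newton_subXn N _ _) => [m /andP[m_gt0 lemN]|].
    rewrite subrr gtnNdvd ?mulr0n //.
    by rewrite (leq_trans _ (leq_pmull _ n_gt0)).
  by rewrite muln_gt0 n_gt0.
apply: eq_newton (newtonM newtP newtQ) => m _.
by rewrite -mulrnBl intS opprD mulrDr mulrN1 addrC.
Qed.

(** The bound [D] allows a recursive choice of [a]: [ghost a n n] lacks exactly the term [d = n],
    the one still to be chosen. *)
Definition ghost (a : nat -> int) (D n : nat) : int :=
  \sum_(1 <= d < D | (d %| n)%N) d%:Z * a d.

Lemma ghostS (a : nat -> int) (D n : nat) : (0 < D)%N ->
  ghost a D.+1 n = ghost a D n + (D%:Z * a D) *+ (D %| n)%N.
Proof.
move=> D_gt0; rewrite /ghost big_mkcond big_nat_recr //= -big_mkcond /=.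
by case: (D %| n)%N.
Qed.

Lemma newton_ghost (a : nat -> int) (N D : nat) : (0 < D)%N ->
  exists P : {poly int}, P`_0 = 1 /\ newton N P (ghost a D).
Proof.
case: D => // D _; elim: D => [|D [P [P01 newtP]]].
  exists 1; rewrite coef1; split=> //; apply: eq_newton (@newton_const N) => m _.
  by rewrite /ghost big_geq.
have [Q [Q01 newtQ]] := @newton_factor N D.+1 (a D.+1) isT.
exists (P * Q); split; first by rewrite coef0M P01 Q01.
by apply: eq_newton (newtonM newtP newtQ) => m _; rewrite [RHS]ghostS.
Qed.

(** Newton sums below [n] determine the coefficients below [n], as the integers have no torsion. In
    the two [n]-th identities everything then cancels except the [n]-th coefficients and the [n]-th
    sums. *)
Lemma newton_sub (N n : nat) (P Q : {poly int}) (b c : nat -> int) :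
  (0 < n <= N)%N -> P`_0 = 1 -> Q`_0 = 1 -> newton N P b -> newton N Q c ->
  (forall m, (0 < m < n)%N -> b m = c m) -> b n - c n = (Q`_n - P`_n) *+ n.
Proof.
move=> nN P01 Q01 newtP newtQ eq_bc.
have eqPQ m : (m < n)%N -> P`_m = Q`_m.
  elim/ltn_ind: m => -[|m] IHm ltmn; first by rewrite P01.
  have mN : (0 < m.+1 <= N)%N.
    by case/andP: nN => _; apply: leq_trans (ltnW ltmn).
  have := etrans (newtP _ mN) (esym (newtQ _ mN)).
  have -> : \sum_(i < m.+1) P`_i * b (m.+1 - i)%N =
            \sum_(i < m.+1) Q`_i * c (m.+1 - i)%N.
    apply: eq_bigr => i _; rewrite IHm ?(ltn_trans (ltn_ord i) ltmn) //.
    by rewrite eq_bc // subn_gt0 ltn_ord (leq_ltn_trans (leq_subr _ _) ltmn).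
  by move/addIr/eqP; rewrite Num.Theory.eqrMn2r //; move/eqP.
have := etrans (newtP _ nN) (esym (newtQ _ nN)).
case: n nN eq_bc eqPQ => // n nN eq_bc eqPQ.
rewrite !big_ord_recl P01 Q01 !mul1r !subn0.
rewrite (_ : \sum_(i < n) P`_(lift ord0 i) * _ =
             \sum_(i < n) Q`_(lift ord0 i) * c (n.+1 - lift ord0 i)%N).
  rewrite !addrA => /addIr; rewrite mulrnBl => eqD.
  by apply/eqP; rewrite subr_eq addrAC -eqD addrAC subrr add0r.
apply: eq_bigr => i _; rewrite lift0 eqPQ ?ltnS // eq_bc //.
by rewrite subn_gt0 ltnS ltn_ord subSS ltnS leq_subr.
Qed.

(** * Newton's identities for the characteristic polynomial *)

Lemma deriv_prod (R : comNzRingType) (I : finType) (F : I -> {poly R}) :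
  (\prod_i F i)^`() = \sum_i \prod_j (if j == i then (F j)^`() else F j).
Proof.
suff Ps (s : seq I) : uniq s -> (\prod_(i <- s) F i)^`() =
    \sum_(i <- s) \prod_(j <- s) (if j == i then (F j)^`() else F j).
  by rewrite Ps // index_enum_uniq.
elim: s => [|x s IHs] /=; first by rewrite !big_nil derivC.
case/andP=> xNs uniq_s; rewrite !big_cons derivM IHs // eqxx; congr (_ * _ + _).
  rewrite big_seq [RHS]big_seq; apply: eq_bigr => j js.
  by case: eqP => // jx; rewrite -jx js in xNs.
rewrite mulr_sumr big_seq [RHS]big_seq; apply: eq_bigr => i si.
by rewrite big_cons; case: eqP => // xi; rewrite xi si in xNs.
Qed.

Lemma deriv_det (R : comNzRingType) (n : nat) (M : 'M[{poly R}]_n) :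
  (\det M)^`() =
  \sum_i \det (\matrix_(k, j) (if k == i then (M k j)^`() else M k j)).
Proof.
rewrite /determinant raddf_sum exchange_big; apply: eq_bigr => s _.
rewrite /= mulr_sign (fun_if (@deriv R)) derivN -mulr_sign deriv_prod mulr_sumr.
apply: eq_bigr => i _.
by congr (_ * _); apply: eq_bigr => k _; rewrite mxE.
Qed.

(** Differentiating row [i] of [char_poly_mx A] leaves the [i]-th unit vector; expanding along it
    gives the diagonal cofactor. *)
Lemma deriv_char_poly (R : comNzRingType) (n : nat) (A : 'M[R]_n) :
  (char_poly A)^`() = \tr (\adj (char_poly_mx A)).
Proof.
rewrite deriv_det; apply: eq_bigr => i _; rewrite (expand_det_row _ i).
rewrite (bigD1 i) //= big1 ?addr0 => [|j /negPf ij].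
  rewrite mxE eqxx !mxE eqxx mulr1n derivB derivX derivC subr0 mul1r.
  rewrite /cofactor; congr (_ * \det _); apply/matrixP => k l.
  by rewrite !mxE eq_sym (negPf (neq_lift _ _)).
by rewrite !mxE eqxx eq_sym ij mulr0n derivB !derivC subr0 mul0r.
Qed.

Lemma horner_mx_sum (R : comNzRingType) (r : nat) (A : 'M[R]_r.+1) (p : {poly R}) :
  horner_mx A p = \sum_(k < size p) p`_k *: A ^+ k.
Proof.
rewrite -[p in LHS]coefK poly_def rmorph_sum /=.
apply: eq_bigr => k _; rewrite -mul_polyC rmorphM rmorphXn /=.
by rewrite horner_mx_C horner_mx_X -mulmxE mul_scalar_mx.
Qed.

(** The inner sum times ['X - A] telescopes to ['X^k - A^k]. Weighting by the coefficients of
    [p = char_poly A] gives [p('X) - p(A)], which is [p('X)] by Cayley-Hamilton. Multiplying by the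
    adjugate and cancelling [p] finishes. *)
Lemma adj_char_poly_mx (R : idomainType) (r : nat) (A : 'M[R]_r.+1) :
  \adj (char_poly_mx A) =
  \sum_(k < r.+2) ((char_poly A)`_k)%:P *:
    \sum_(i < k) 'X^(k.-1 - i) *: map_mx (@polyC R) (A ^+ i).
Proof.
set S := RHS; set p := char_poly A; pose A' := map_mx (@polyC R) A.
have szp : size p = r.+2 by rewrite size_char_poly.
have p_neq0 : p != 0 by rewrite -size_poly_eq0 szp.
have XAS : char_poly_mx A *m S = p%:M.
  have XAk k : char_poly_mx A *m
      (\sum_(i < k) 'X^(k.-1 - i) *: map_mx (@polyC R) (A ^+ i)) =
      ('X^k)%:M - map_mx (@polyC R) (A ^+ k).
    rewrite /char_poly_mx -/A' (rmorphXn (@scalar_mx _ _)) rmorphXn /= -/A'.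
    rewrite subrXX_comm; last exact: comm_scalar_mx.
    congr (_ *m _); apply: eq_bigr => i _.
    by rewrite -mul_scalar_mx !rmorphXn.
  rewrite mulmx_sumr; under eq_bigr => k _ do
    rewrite -scalemxAr XAk scalerBr scale_scalar_mx.
  rewrite big_split /= sumrN.
  have -> : \sum_(k < r.+2) (p`_k)%:P *: map_mx (@polyC R) (A ^+ k) = 0.
    transitivity (map_mx (@polyC R) (horner_mx A p)); last first.
      by rewrite Cayley_Hamilton map_mx0.
    by rewrite horner_mx_sum szp raddf_sum; apply: eq_bigr => k _; rewrite /= map_mxZ.
  rewrite subr0 -raddf_sum /=; congr _%:M.
  rewrite -[RHS]coefK szp poly_def; apply: eq_bigr => k _.
  by rewrite mul_polyC.
have := congr1 (mulmx (\adj (char_poly_mx A))) XAS.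
rewrite mulmxA mul_adj_mx mul_scalar_mx mul_mx_scalar -/p => /matrixP eqS.
by apply/matrixP=> i j; apply: (mulfI p_neq0); move: (eqS i j); rewrite !mxE.
Qed.

Lemma coef_char_poly_trace (R : idomainType) (r : nat) (A : 'M[R]_r.+1) (j : nat) :
  (char_poly A)`_j.+1 *+ j.+1 =
  \sum_(k < r.+2) (char_poly A)`_k *
    (if (j < k)%N then \tr (A ^+ (k.-1 - j)) else 0).
Proof.
rewrite -coef_deriv deriv_char_poly adj_char_poly_mx (raddf_sum (@mxtrace _ _)).
rewrite coef_sum; apply: eq_bigr => k _.
rewrite /= mxtraceZ coefCM (raddf_sum (@mxtrace _ _)); congr (_ * _).
rewrite -(coef_poly k (fun l => \tr (A ^+ (k.-1 - l)))) poly_def.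
rewrite (reindex_inj rev_ord_inj) /=; congr (nth 0 (polyseq _) _).
apply: eq_bigr => i _; rewrite mxtraceZ trace_map_mx mulrC mul_polyC.
by congr (\tr (A ^+ _) *: 'X^_); case: i => i /= ltik; lia.
Qed.

(** The reversed polynomial is [det (1 - 'X A)]. Degree [r.+1] is the trace of Cayley-Hamilton;
    lower degrees come from [coef_char_poly_trace]. *)
Lemma newton_char_poly (r : nat) (A : 'M[int]_r.+1) :
  newton r.+1 (\poly_(i < r.+2) (char_poly A)`_(r.+1 - i)) (fun i => \tr (A ^+ i)).
Proof.
set p := char_poly A => n /andP[n_gt0 lenr].
have coefP i : (i <= r.+1)%N -> (\poly_(i < r.+2) p`_(r.+1 - i))`_i = p`_(r.+1 - i).
  by move=> ler; rewrite coef_poly ltnS ler.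
rewrite coefP //; under eq_bigr => i _ do
  rewrite coefP ?(leq_trans (ltnW (ltn_ord i))) //.
case: (ltngtP n r.+1) lenr => // [ltnr _ | -> _]; last first.
  have := congr1 mxtrace (Cayley_Hamilton A).
  rewrite mxtrace0 -/p horner_mx_sum size_char_poly raddf_sum /=.
  under eq_bigr => k _ do rewrite mxtraceZ.
  rewrite big_ord_recl expr0 mxtrace1 mulr_natr subnn => eq0.
  rewrite -[RHS]eq0; congr (_ + _).
  rewrite (reindex_inj rev_ord_inj) /=; apply: eq_bigr => i _.
  by rewrite subKn.
have := coef_char_poly_trace A (r - n)%N; rewrite -/p.
have -> : \sum_(k < r.+2) p`_k *
    (if (r - n < k)%N then \tr (A ^+ (k.-1 - (r - n))) else 0) =
    \sum_(i < n.+1) p`_(r.+1 - i) * \tr (A ^+ (n - i)).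
  rewrite (big_ord_widen r.+2 (fun i => p`_(r.+1 - i) * \tr (A ^+ (n - i)))); last by lia.
  rewrite (reindex_inj rev_ord_inj) [RHS]big_mkcond /=; apply: eq_bigr => i _.
  rewrite subSS; have -> : (r - n < r.+1 - i)%N = (i < n.+1)%N by lia.
  case: ifP => ltin; last by rewrite mulr0.
  by congr (_ * \tr (A ^+ _)); lia.
rewrite big_ord_recr /= subnn expr0 mxtrace1 mulr_natr.
rewrite subSn //; set q := p`__; set S := \sum_(_ < n) _.
(* The factor [r.+1] is the trace of [A ^+ 0]; the part [(r - n).+1] cancels against the
   derivative. *)
have -> : q *+ r.+1 = q *+ n + q *+ (r - n).+1.
  by rewrite -mulrnDr; congr (_ *+ _); lia.
by rewrite addrA -[X in X = _]add0r => /addIr/esym; rewrite addrC.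
Qed.

Lemma newton_inj (N : nat) (P : {poly int}) (b c : nat -> int) :
  P`_0 = 1 -> newton N P b -> newton N P c ->
  forall n, (0 < n <= N)%N -> b n = c n.
Proof.
move=> P01 newtPb newtPc; elim/ltn_ind=> n IHn nN.
apply/eqP; rewrite -subr_eq0 (newton_sub nN P01 P01 newtPb newtPc) ?subrr ?mul0rn //.
by move=> m /andP[m_gt0 ltmn]; apply: IHn => //; lia.
Qed.

(** * Divisor sums and congruences modulo prime powers *)

(** Otherwise [d] is [d' * p ^ e] with [e <= k] and [d'] prime to [p]; then [d'] divides [m], so [d]
    divides [m * p ^ k]. *)
Lemma pfactor_dvdn_of_ndvdn (p k m d : nat) : prime p -> (0 < m)%N ->
  (d %| m * p ^ k.+1)%N -> ~~ (d %| m * p ^ k)%N -> (p ^ k.+1 %| d)%N.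
Proof.
move=> p_pr m_gt0 d_dvd; apply: contraR => pk_ndvd.
have p_gt0 := prime_gt0 p_pr.
have d_gt0 : (0 < d)%N by rewrite (dvdn_gt0 _ d_dvd) // muln_gt0 m_gt0 expn_gt0 p_gt0.
rewrite pfactor_dvdn // -ltnNge ltnS in pk_ndvd.
have [d' cop_pd' dE] := pfactor_coprime p_pr d_gt0.
rewrite dE dvdn_mul ?dvdn_exp2l //.
rewrite -(@Gauss_dvdl _ _ (p ^ k.+1)) ?coprimeXr // 1?coprime_sym //.
by rewrite (dvdn_trans _ d_dvd) // dE dvdn_mulr.
Qed.

(** Only divisors of [m * p ^ k.+1] that do not divide [m * p ^ k] survive in the difference. *)
Lemma ghost_modp (a : nat -> int) (D p k m : nat) :
  prime p -> (0 < m)%N ->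
  ((p ^ k.+1)%N%:Z %| ghost a D (m * p ^ k.+1) - ghost a D (m * p ^ k))%Z.
Proof.
move=> p_pr m_gt0; rewrite /ghost big_mkcond [X in _ - X]big_mkcond -sumrB.
apply: rpred_sum => d _; case: ifP => d1; case: ifP => d0.
- by rewrite subrr dvdz0.
- by rewrite subr0 dvdz_mulr // dvdzE /= (@pfactor_dvdn_of_ndvdn p k m) // d0.
- by rewrite expnS mulnCA dvdn_mull in d1.
by rewrite subrr dvdz0.
Qed.

(** At each stage the quotient of [b n - ghost a n n] by [n] becomes the new [a n]; earlier sums do
    not see it. *)
Lemma ghost_lift (r : nat) (b : nat -> int) :
  (forall n (a : nat -> int), (0 < n <= r)%N ->
     (forall m, (0 < m < n)%N -> b m = ghost a n m) ->
     (n%:Z %| b n - ghost a n n)%Z) ->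
  exists a, forall n, (0 < n <= r)%N -> b n = ghost a r.+1 n.
Proof.
elim: r => [|r IHr] bP; first by exists (fun=> 0) => n; lia.
have [|a eq_ba] := IHr; first by move=> n a nr; apply: bP; lia.
have /dvdzP[q qE] := bP r.+1 a (leqnn _) eq_ba.
exists (fun d => if d == r.+1 then q else a d) => n /andP[n_gt0 lenr].
have ghostE : ghost (fun d => if d == r.+1 then q else a d) r.+1 n = ghost a r.+1 n.
  rewrite /ghost big_nat_cond [RHS]big_nat_cond; apply: eq_bigr => d.
  by case/andP=> /andP[_ /ltn_eqF ->].
rewrite ghostS // ghostE eqxx; case: (ltngtP n r.+1) lenr => // [ltnr _ | -> _].
  by rewrite gtnNdvd // addr0 eq_ba // n_gt0.
by rewrite dvdnn mulr1n mulrC -qE addrC subrK.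
Qed.

Lemma dvdz_partP (n : nat) (x : int) : (0 < n)%N ->
  (forall p k m : nat, prime p -> (0 < m)%N -> n = (m * p ^ k.+1)%N ->
     coprime m p -> ((p ^ k.+1)%N%:Z %| x)%Z) -> (n%:Z %| x)%Z.
Proof.
move=> n_gt0 xP; rewrite dvdzE /=; apply/(dvdn_partP _ n_gt0) => p.
rewrite mem_primes => /and3P[p_pr _ p_dvd].
have [m cop_pm nE] := pfactor_coprime p_pr n_gt0.
have : (0 < logn p n)%N by rewrite logn_gt0 mem_primes p_pr n_gt0.
rewrite p_part; case: (logn p n) nE => // k nE _.
have m_gt0 : (0 < m)%N by move: n_gt0; rewrite nE muln_gt0 => /andP[].
by have := xP p k m p_pr m_gt0 nE; rewrite coprime_sym dvdzE => /(_ cop_pm).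
Qed.

(** * Realisation by companion matrices, and the equivalence *)

Lemma exists_char_poly (R : comNzRingType) (n : nat) (p : {poly R}) :
  p \is monic -> size p = n.+1 -> exists f : 'M[R]_n, char_poly f = p.
Proof.
move=> p_monic szp; have -> : n = (size p).-1 by rewrite szp.
by exists (companionmx p); apply: companionmxK.
Qed.

(** Reversing [P], cut at degree [r.+1], gives a monic polynomial as [P] has constant term 1. The
    traces of its companion matrix satisfy the same identities as [b], which determine them. *)
Lemma newton_char_poly_ex (r : nat) (P : {poly int}) (b : nat -> int) :
  P`_0 = 1 -> newton r.+1 P b ->
  exists f : 'M[int]_r.+1, forall i, (0 < i <= r.+1)%N -> b i = \tr (f ^+ i).
Proof.
move=> P01 newtP; pose p : {poly int} := \poly_(i < r.+2) P`_(r.+1 - i).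
have szp : size p = r.+2 by rewrite size_poly_eq // subnn P01.
have p_monic : p \is monic.
  by rewrite monicE lead_coefE szp coef_poly ltnSn subnn P01.
have [f pE] := exists_char_poly p_monic szp.
exists f; apply: (newton_inj P01 newtP) => n nr.
rewrite -[RHS](newton_char_poly f nr) pE.
have coefP i : (i <= n)%N -> (\poly_(i < r.+2) p`_(r.+1 - i))`_i = P`_i.
  by move=> lein; rewrite !coef_poly !ifT; [congr P`_ _|..]; lia.
rewrite coefP //; congr (_ + _); apply: eq_bigr => i _.
by rewrite coefP // ltnW.
Qed.

Unset Implicit Arguments.

Theorem theorem13 (r : nat) (hr : (1 <= r)%N) (b : nat -> int) :
  (exists f : 'M[int]_r,
     forall i : nat, (1 <= i <= r)%N -> b i = \tr (f ^+ i))
  <->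
  (forall n : nat, (1 <= n <= r)%N ->
   forall p k m : nat, prime p -> (1 <= k)%N -> (1 <= m)%N ->
     n = (m * p ^ k)%N -> coprime m p ->
     (b n = b (n %/ p)%N %[mod (p ^ k)%N%:Z])%Z).
Proof.
have divE p k m : prime p -> (m * p ^ k.+1 %/ p)%N = (m * p ^ k)%N.
  by move=> p_pr; rewrite expnSr mulnA mulnK ?prime_gt0.
have bP : (forall n : nat, (1 <= n <= r)%N ->
   forall p k m : nat, prime p -> (1 <= k)%N -> (1 <= m)%N ->
     n = (m * p ^ k)%N -> coprime m p ->
     (b n = b (n %/ p)%N %[mod (p ^ k)%N%:Z])%Z) <->
   exists a, forall n, (0 < n <= r)%N -> b n = ghost a r.+1 n.
  split=> [b_mod | [a bE] n nr p [//|k] m p_pr _ m_gt0 nE _].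
    apply: ghost_lift => n a nr bE; apply: dvdz_partP; first by case/andP: nr.
    move=> p k m p_pr m_gt0 nE cop_mp.
    have := b_mod n nr p k.+1 m p_pr isT m_gt0 nE cop_mp.
    move/eqP; rewrite eqz_mod_dvd {2}nE divE //.
    have pk_gt0 : (0 < p ^ k)%N by rewrite expn_gt0 prime_gt0.
    (* The index [m * p ^ k] is [n %/ p], hence below [n], where [b] is already a divisor sum. *)
    rewrite (bE (m * p ^ k)%N); last first.
      by rewrite nE muln_gt0 m_gt0 pk_gt0 ltn_pmul2l // ltn_exp2l ?prime_gt1 /=.
    have := ghost_modp a n k p_pr m_gt0; rewrite -nE => dvd_g dvd_b.
    have -> : b n - ghost a n n = (b n - ghost a n (m * p ^ k)%N) -
      (ghost a n n - ghost a n (m * p ^ k)%N) by rewrite opprB addrA subrK.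
    exact: rpredB.
  apply/eqP; rewrite eqz_mod_dvd !bE //; last first.
    rewrite nE divE // muln_gt0 m_gt0 expn_gt0 prime_gt0 //=.
    case/andP: nr => _; rewrite nE; apply: leq_trans.
    by rewrite leq_pmul2l // leq_exp2l ?prime_gt1.
  by rewrite nE divE // ghost_modp.
apply: iff_trans (iff_sym bP); case: r hr {bP divE} => // r _; split.
  case=> f bE; apply: ghost_lift => n a nr eq_ba.
  have n_gt0 : (0 < n)%N by case/andP: nr.
  have [Q [Q01 newtQ]] := newton_ghost a r.+1 n_gt0.
  have newtf := eq_newton (fun i ir => esym (bE i ir)) (newton_char_poly f).
  (* The side goal, constant term 1, is monicity of the characteristic polynomial. *)
  rewrite (newton_sub nr _ Q01 newtf newtQ eq_ba); last first.
    rewrite coef_poly subn0 /=.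
    by have := char_poly_monic f; rewrite monicE lead_coefE size_char_poly => /eqP.
  by rewrite -mulr_natr natz dvdz_mull.
case=> a bE; have [P [P01 newtP]] := @newton_ghost a r.+1 r.+2 isT.
apply: (newton_char_poly_ex P01) => //.
by apply: eq_newton newtP => n nr; rewrite bE.
Qed.
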